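(* Let $T$ be a tournament of (finite) diameter $d$. Then $d-1\le\overrightarrow{rvc}(T)\le d+3$.
   Context: A tournament is a digraph in which every two distinct vertices are joined by exactly one arc (in one direction). A (directed) path is a sequence of distinct vertices $x_0,\dots,x_\ell$ with each $x_{i-1}x_i$ an arc; its length is $\ell$. A digraph is strongly connected if for every ordered pair $(u,v)$ there is a $u$–$v$ path; $d(u,v)$ is the length of a shortest $u$–$v$ path, and the diameter is the maximum of $d(u,v)$ over ordered pairs (finite diameter means $T$ is strongly connected). In a vertex-coloured digraph, a path is rainbow if its internal vertices have pairwise distinct colours. A vertex-colouring of a strongly connected digraph $D$ is rainbow vertex-connected if every ordered pair $(u,v)$ is joined by a rainbow $u$–$v$ path. $\overrightarrow{rvc}(D)$ is the minimum number of colours in a rainbow vertex-connected vertex-colouring of $D$. *)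

(* Defs.v *)
From mathcomp Require Import all_boot.

Set Implicit Arguments.
Unset Strict Implicit.
Unset Printing Implicit Defensive.

(* A digraph on the vertex set V is its arc relation e : rel V. *)

Definition tournament (V : finType) (e : rel V) : Prop :=
  irreflexive e /\ forall x y, x != y -> e x y (+) e y x.

(* The path x_0, ..., x_l is represented by u = x_0 and p = [:: x_1; ...; x_l],
   so that its length is size p. *)
Definition dipath (V : finType) (e : rel V) (u v : V) (p : seq V) : bool :=
  [&& path e u p, uniq (u :: p) & last u p == v].

Definition strongly_connected (V : finType) (e : rel V) : Prop :=
  forall u v, exists p, dipath e u v p.

Definition dipath_of_length (V : finType) (e : rel V) (u v : V) : pred nat :=
  fun l => [exists p : l.-tuple V, dipath e u v p].

Lemma dipath_of_lengthP (V : finType) (e : rel V) (u v : V) (l : nat) :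
  reflect (exists2 p, dipath e u v p & size p = l) (dipath_of_length e u v l).
Proof.
apply: (iffP existsP) => [[p pP]|[p pP <-]]; last by exists (in_tuple p).
by exists p => //; rewrite size_tuple.
Qed.

Lemma strongly_connected_length (V : finType) (e : rel V) :
  strongly_connected e -> forall u v, exists l, dipath_of_length e u v l.
Proof.
move=> sc u v; have [p pP] := sc u v.
by exists (size p); apply/dipath_of_lengthP; exists p.
Qed.

Definition dist (V : finType) (e : rel V) (sc : strongly_connected e)
    (u v : V) : nat :=
  ex_minn (strongly_connected_length sc u v).

Definition diameter (V : finType) (e : rel V) (sc : strongly_connected e) : nat :=
  \max_(u : V) \max_(v : V) dist sc u v.

(* [:: x_1; ...; x_(l-1)] for the path x_0, ..., x_l; empty when l <= 1. *)
Definition internal (V : finType) (u : V) (p : seq V) : seq V :=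
  behead (belast u p).

Definition rainbow (V : finType) (C : eqType) (c : V -> C) (u : V) (p : seq V)
    : bool :=
  uniq (map c (internal u p)).

(* The bound l < #|V| loses no path, since the vertices of a path are distinct;
   see rainbow_vertex_connectedP. *)
Definition rainbow_vertex_connected (V : finType) (e : rel V) (C : eqType)
    (c : V -> C) : bool :=
  [forall u, forall v, exists l : 'I_#|V|, exists p : l.-tuple V,
    dipath e u v p && rainbow c u p].

Lemma size_dipath (V : finType) (e : rel V) (u v : V) (p : seq V) :
  dipath e u v p -> size p < #|V|.
Proof.
by case/and3P=> _ /card_uniqP up _; rewrite -[_.+1]up max_card.
Qed.

Lemma rainbow_vertex_connectedP (V : finType) (e : rel V) (C : eqType)
    (c : V -> C) :
  reflect (forall u v, exists2 p, dipath e u v p & rainbow c u p)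
          (rainbow_vertex_connected e c).
Proof.
apply: (iffP idP) => [/forallP h u v|h].
  have /forallP /(_ v) /existsP [l /existsP [p /andP [pP cP]]] := h u.
  by exists p.
apply/forallP => u; apply/forallP => v; have [p pP cP] := h u v.
apply/existsP; exists (Ordinal (size_dipath pP)).
by apply/existsP; exists (in_tuple p); rewrite pP.
Qed.

(* k colours suffice. Not all of them need be used, which does not affect the
   least such k. *)
Definition rvc_colourable (V : finType) (e : rel V) : pred nat :=
  fun k => [exists c : {ffun V -> 'I_k}, rainbow_vertex_connected e c].

Lemma rvc_colourable_card (V : finType) (e : rel V) :
  strongly_connected e -> exists k, rvc_colourable e k.
Proof.
move=> sc; exists #|V|; apply/existsP; exists [ffun x => enum_rank x].
apply/rainbow_vertex_connectedP => u v; have [p pP] := sc u v.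
exists p => //; rewrite /rainbow map_inj_uniq.
  case/and3P: pP => _ /= /andP[_ up] _; rewrite /internal.
  case: p up => //= x p up; have := up; rewrite -[x \notin p]/(_) -cons_uniq.
  by rewrite lastI rcons_uniq => /andP[].
by move=> x y; rewrite !ffunE => /enum_rank_inj.
Qed.

Definition rvc (V : finType) (e : rel V) (sc : strongly_connected e) : nat :=
  ex_minn (rvc_colourable_card sc).

(* Main.v *)
(* For the upper bound let z be a king: every vertex is reached from z by at
   most two arcs.  Let S be the set of vertices at distance 2 to z and R the set
   of those at distance at least 3.  Choose a in R which every vertex of R
   reaches by at most two arcs inside R, and a shortest path P from a to z.
   Give the at most d + 1 vertices of P distinct colours, the vertices of S
   outside P one new colour, and all remaining vertices another one.
   A vertex v of R reaches z through at most one vertex of R and then P; any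
   other v reaches z through at most one in-neighbour of z.  From z, any u is
   reached through at most one vertex y, and y is in S since y -> u -> z.
   So a walk from v to u meets at most one vertex of each of the last two
   colours outside P. *)
Require Import Defs.
From mathcomp Require Import all_boot.

(** Shortening the walk to a path keeps only vertices of [p], and [v], being the last vertex of a
    path, is not internal. Hence the constructions below need only produce walks. *)
Lemma rainbow_dipath_of_walk (V : finType) (e : rel V) (C : eqType) (c : V -> C)
    (u v : V) (p : seq V) :
  path e u p -> last u p = v -> {in [predD1 p & v] &, injective c} ->
  exists2 q, dipath e u v q & rainbow c u q.
Proof.
move=> ep pv; case/shortenP: ep pv => q eq uq sqp qv injc; exists q.
  by rewrite /dipath eq uq qv eqxx.
rewrite /rainbow map_inj_in_uniq /internal.
  case: q uq {eq sqp qv} => //= x q /andP[_]; rewrite -cons_uniq.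
  by rewrite lastI rcons_uniq => /andP[].
suff sub x : x \in behead (belast u q) -> x \in [predD1 p & v].
  by move=> x y /sub xp /sub yp; apply: injc.
case: q uq sqp qv {eq} => //= y q /andP[_]; rewrite -cons_uniq lastI rcons_uniq.
move=> /andP[lq _] sqp <- xq; rewrite inE /= sqp ?mem_rcons ?inE ?xq ?orbT //.
by rewrite andbT; apply: contraNneq lq => <-.
Qed.

Lemma rvc_colourable_nat (V : finType) (e : rel V) (k : nat) (c : V -> nat) :
  (forall x, c x < k) -> rainbow_vertex_connected e c -> rvc_colourable e k.
Proof.
move=> ck /rainbow_vertex_connectedP h; apply/existsP.
exists [ffun x => Ordinal (ck x)]; apply/rainbow_vertex_connectedP => u v.
have [p pP cP] := h u v; exists p => //; move: cP; rewrite /rainbow.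
have -> : [seq c x | x <- internal u p] =
    map val [seq [ffun x => Ordinal (ck x)] x | x <- internal u p].
  by rewrite -map_comp; apply: eq_map => x /=; rewrite ffunE.
exact: map_uniq.
Qed.

Lemma tournament_converse (V : finType) (e : rel V) :
  tournament e -> tournament (fun x y => e y x).
Proof.
by move=> [irr tot]; split=> // x y xy; rewrite addbC; apply: tot.
Qed.

Lemma tournament_asym (V : finType) (e : rel V) (x y : V) :
  tournament e -> e x y -> ~~ e y x.
Proof.
move=> [irr tot] xy; have /tot : x != y.
  by apply: contraTneq xy => ->; rewrite irr.
by rewrite xy.
Qed.

Lemma tournament_total (V : finType) (e : rel V) (x y : V) :
  tournament e -> x != y -> ~~ e x y -> e y x.
Proof. by move=> [_ tot] /tot; case: (e x y). Qed.

(** Take [a] of maximal in-degree inside [A]. If [x] did not reach [a] within two arcs, every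
    in-neighbour of [a] in [A], and [a] itself, would be an in-neighbour of [x], contradicting
    maximality. *)
Lemma tournament_in_king (V : finType) (e : rel V) (A : {set V}) (a0 : V) :
  tournament e -> a0 \in A ->
  exists2 a, a \in A & forall x, x \in A ->
    [\/ x = a, e x a | exists y, [/\ y \in A, e x y & e y a]].
Proof.
move=> te Aa0; pose N x := [set y in A | e y x].
have [a Aa maxa] := arg_maxnP (fun x => #|N x|) Aa0.
exists a => // x Ax; have [->|xa] := eqVneq x a; first by constructor 1.
have [exa|nexa] := boolP (e x a); first by constructor 2.
constructor 3; have eax := tournament_total _ _ _ _ te xa nexa.
have [/existsP[y /and3P[? ? ?]]|/existsPn no] :=
  boolP [exists y, [&& y \in A, e x y & e y a]]; first by exists y.
suff /proper_card lt : N a \proper N x.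
  by have := leq_trans lt (maxa x Ax); rewrite ltnn.
apply/properP; split; last by exists a; rewrite inE ?te.1 ?andbF // eax andbT.
apply/subsetP => y; rewrite !inE => /andP[Ay eya]; rewrite Ay /=.
apply: tournament_total te _ _; first by apply: contraNneq nexa => ->.
by have := no y; rewrite Ay eya andbT.
Qed.

Lemma dist_dipath (V : finType) (e : rel V) (sc : strongly_connected e)
    (u v : V) :
  exists2 p, dipath e u v p & size p = dist sc u v.
Proof. by rewrite /dist; case: ex_minnP => l /dipath_of_lengthP. Qed.

Lemma dist_min (V : finType) (e : rel V) (sc : strongly_connected e) (u v : V)
    (p : seq V) :
  dipath e u v p -> dist sc u v <= size p.
Proof.
move=> pP; rewrite /dist; case: ex_minnP => l _; apply.
by apply/dipath_of_lengthP; exists p.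
Qed.

Lemma dist_diameter (V : finType) (e : rel V) (sc : strongly_connected e)
    (u v : V) :
  dist sc u v <= diameter sc.
Proof.
apply: leq_trans (leq_bigmax u).
exact: (leq_bigmax (F := fun w => dist sc u w)).
Qed.

(** A rainbow path of length [l > 0] has [l - 1] internal vertices of distinct colours. *)
Lemma diameter_le_colours (V : finType) (e : rel V) (sc : strongly_connected e)
    (k : nat) :
  rvc_colourable e k -> diameter sc <= k.+1.
Proof.
move=> /existsP[c /rainbow_vertex_connectedP h].
apply/bigmax_leqP => u _; apply/bigmax_leqP => v _.
have [p pP /card_uniqP] := h u v.
rewrite size_map size_behead size_belast => cP.
apply: leq_trans (dist_min _ _ sc _ _ _ pP) _.
apply: leq_trans (leqSpred _) _.
by rewrite ltnS -cP -[k in _ <= k]card_ord max_card.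
Qed.

Lemma rvc_colourable_diameter (V : finType) (e : rel V)
    (sc : strongly_connected e) :
  tournament e -> rvc_colourable e (diameter sc).+3.
Proof.
move=> te; set d := diameter sc.
case: (pickP (@predT V)) => [z0 _|V0]; last first.
  apply/existsP; exists [ffun=> ord0].
  by apply/rainbow_vertex_connectedP => u; have := V0 u.
(* In the converse tournament the arcs turn round, so [z] reaches every vertex. *)
have [z _ kingz] :=
  tournament_in_king _ _ _ _ (tournament_converse _ _ te) (in_setT z0).
pose S := [pred x | e z x && [exists w, e x w && e w z]].
pose R := [set x | [&& x != z, e z x & x \notin S]].
have [a [p [ep pz sp kinga]]] : exists a p, [/\ path e a p, last a p = z,
    size p <= d & forall x, x \in R ->
    [\/ x = a, e x a | exists y, [/\ y \in R, e x y & e y a]]].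
  (* If [R] is empty, the trivial path at [z] will do. *)
  have [R0|[a0 Ra0]] := set_0Vmem R.
    by exists z, [::]; split=> // x; rewrite R0 inE.
  have [a _ kinga] := tournament_in_king _ _ _ _ te Ra0.
  have [p /and3P[ep _ /eqP pz] sp] := dist_dipath _ _ sc a z.
  by exists a, p; split; rewrite // sp dist_diameter.
pose P := a :: p.
have zP : z \in P by rewrite -pz mem_last.
pose c x := if x \in P then index x P else if x \in S then d.+1 else d.+2.
(* Colours up to [d] occur only on [P], once each, so a clash needs two vertices off [P] on the same
   side of [S]. *)
have c_inj (q : seq V) : (forall x y, x \in q -> y \in q -> x \notin P ->
    y \notin P -> (x \in S) = (y \in S) -> x = y) -> {in q &, injective c}.
  have cP x : x \in P -> c x < d.+1.
    rewrite /c => xP; rewrite xP.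
    by rewrite (leq_trans _ (sp : size P <= d.+1)) ?index_mem.
  have cNP x : x \notin P -> d < c x.
    by rewrite /c => /negbTE->; case: ifP.
  move=> qP x y xq yq; have [xP|xP] := boolP (x \in P).
    have [yP|yP] := boolP (y \in P); last first.
      by move=> cxy; have := cNP _ yP; rewrite -cxy ltnNge -ltnS cP.
    by rewrite /c xP yP => /(congr1 (nth z P)); rewrite !nth_index.
  have [yP|yP] := boolP (y \in P).
    by move=> cxy; have := cNP _ xP; rewrite cxy ltnNge -ltnS cP.
  move=> cxy; apply: qP => //; move: cxy.
  rewrite /c (negbTE xP) (negbTE yP).
  by case: (x \in S) (y \in S) => [] [] //= /eqP; rewrite eqn_leq !ltnn ?andbF.
(* Here [t] is the only vertex of the walk that may lie off [P]; when there is none, [z] stands in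
   for it. *)
have to_z v : exists q, [/\ path e v q, last v q = z &
    exists2 t, t \notin S & {subset q <= t :: P}].
  have zS : z \notin S by rewrite inE /= te.1.
  have [->|vz] := eqVneq v z; first by exists [::]; split=> //; exists z.
  have [evz|nevz] := boolP (e v z).
    exists [:: z]; split; rewrite /= ?evz //; exists z => // x.
    by rewrite !inE => ->.
  have ezv := tournament_total _ _ _ _ te vz nevz.
  have [vS|vS] := boolP (v \in S).
    move: vS; rewrite inE => /andP[_ /existsP[w /andP[evw ewz]]].
    exists [:: w; z]; split; rewrite /= ?evw ?ewz //; exists w.
      (* The arc from [w] to [z] excludes the arc from [z] to [w] that [S] demands. *)
      by rewrite inE negb_and (tournament_asym _ _ _ _ te ewz).
    by move=> x; rewrite !inE => /orP[->//|/eqP->]; rewrite -in_cons zP orbT.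
  have /kinga : v \in R by rewrite inE vz ezv.
  case=> [->|eva|[y [yR evy eya]]].
  - exists p; split=> //; exists z => // x xp.
    by rewrite !inE xp !orbT.
  - exists P; split; rewrite /= ?eva //; exists z => // x xP.
    by rewrite in_cons xP orbT.
  exists (y :: P); split; rewrite /= ?evy ?eya //; exists y => //.
  by move: yR; rewrite inE => /and3P[].
apply: (rvc_colourable_nat _ _ _ c) => [x|].
  rewrite /c; case: ifP => [|_]; last by case: ifP.
  rewrite -index_mem => /leq_trans; apply.
  by rewrite /= ltnS (leq_trans sp) // leqW.
apply/rainbow_vertex_connectedP => v u.
have [q [eq qz [t tS qt]]] := to_z v.
have [uz|uz] := eqVneq u z.
  rewrite uz; apply: rainbow_dipath_of_walk eq qz _ => x y.
  move=> /andP[_ xq] /andP[_ yq]; apply: (c_inj q) xq yq => {}x {}y.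
  move=> /qt + /qt; rewrite !(in_cons t).
  by move=> /orP[/eqP->|->] // /orP[/eqP->|->].
(* The last clause says that [r] has at most one vertex. *)
have [r [er rS r_eq]] : exists r, [/\ path e z (rcons r u), {subset r <= S} &
    {in r &, forall x y, x = y}].
  have := kingz u (in_setT u); case=> [/eqP|ezu|[y [_ eyu ezy]]].
  - by rewrite (negbTE uz).
  - by exists [::]; rewrite /= ezu.
  have [ezu|nezu] := boolP (e z u); first by exists [::]; rewrite /= ezu.
  exists [:: y]; split; rewrite /= ?ezy ?eyu //.
    move=> x; rewrite !inE => /eqP->; rewrite ezy /=; apply/existsP; exists u.
    by rewrite eyu; apply: tournament_total nezu; rewrite // eq_sym.
  by move=> x1 x2; rewrite !inE => /eqP-> /eqP->.
have eqr : path e v (q ++ rcons r u) by rewrite cat_path eq qz.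
apply: rainbow_dipath_of_walk eqr _ _; first by rewrite last_cat last_rcons.
(* Off [P], [q] contributes at most [t], outside [S], and [r] at most one vertex, inside [S]. *)
have qr_inj : {in q ++ r &, injective c}.
  have qrP x : x \in q ++ r -> x \notin P -> x = t \/ x \in r.
    rewrite mem_cat => /orP[/qt|xr]; last by right.
    by rewrite (in_cons t) => /orP[/eqP|->]; first by left.
  apply: c_inj => x y xq yq xP yP.
  case: (qrP x xq xP) (qrP y yq yP) => [->|xr] [->|yr] //.
  - by rewrite (negbTE tS) (rS y yr).
  - by rewrite (negbTE tS) (rS x xr).
  by move=> _; apply: r_eq.
suff sub x : x \in [predD1 q ++ rcons r u & u] -> x \in q ++ r.
  by move=> x y /sub xq /sub yq; apply: qr_inj.
by rewrite !inE mem_cat mem_rcons in_cons mem_cat => /andP[/negbTE->].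
Qed.

Theorem theorem20 (V : finType) (T : rel V) (T_tournament : tournament T)
    (T_sc : strongly_connected T) (d : nat) (T_diam : diameter T_sc = d) :
  d - 1 <= rvc T_sc <= d + 3.
Proof.
rewrite /rvc; case: ex_minnP => k kP kmin; apply/andP; split.
  by rewrite -T_diam leq_subLR diameter_le_colours.
by rewrite -T_diam addn3; apply/kmin/rvc_colourable_diameter.
Qed.
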